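(* Let $s\in C^2(\mathbb{R}^{B_{\mathbf 0}^r},\mathbb{R})$ be admissible. Then $\mathcal{M}_0$ is a nonempty ordered set and the elements of $\mathcal{M}_0$ are solutions of the Euler–Lagrange equation.
   Context: Fix integers $n\ge 1$, $r\ge 1$. For $\mathbf{i}\in\mathbb{Z}^n$ let $\|\mathbf{i}\|=\sum_k|\mathbf{i}_k|$, and $B_{\mathbf 0}^r=\{\mathbf{k}\in\mathbb{Z}^n:\|\mathbf{k}\|\le r\}$; $\mathbf{e}_1,\dots,\mathbf{e}_n$ are the standard unit vectors. A function $s\in C^2(\mathbb{R}^{B_{\mathbf 0}^r},\mathbb{R})$ is called admissible if: (S1) $s(u+1_{B_{\mathbf 0}^r})=s(u)$, with $1_{B_{\mathbf 0}^r}$ the constant function $1$; (S2) $s$ is bounded from below and $s(u)\to\infty$ as $|u(\mathbf{k})-u(\mathbf{j})|\to\infty$, for $\mathbf{k},\mathbf{j}\in B_{\mathbf 0}^r$ with $\|\mathbf{k}-\mathbf{j}\|=1$; (S3) $\partial_{\mathbf{k},\mathbf{j}}s\le 0$ for $\mathbf{k}\ne\mathbf{j}$ in $B_{\mathbf 0}^r$, and $\partial_{\mathbf{0},\mathbf{j}}s<0$ for $\|\mathbf{j}\|=1$. A configuration is a function $u:\mathbb{Z}^n\to\mathbb{R}$. Shifts: $(\tau^j_{-k}u)(\mathbf{i})=u(\mathbf{i}+k\mathbf{e}_j)$ for $k\in\mathbb{Z}$. Local potentials: $S_{\mathbf{j}}(u)=s\big((\tau^n_{-\mathbf{j}_n}\cdots\tau^1_{-\mathbf{j}_1}u)|_{B_{\mathbf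 0}^r}\big)$. A solution of the Euler–Lagrange equation is a configuration $u$ with $\sum_{\mathbf{j}:\|\mathbf{j}-\mathbf{i}\|\le r}\partial_{\mathbf{i}}S_{\mathbf{j}}(u)=0$ for all $\mathbf{i}\in\mathbb{Z}^n$, where $\partial_{\mathbf i}$ is the partial derivative with respect to $u(\mathbf i)$. $u<v$ means $u(\mathbf{i})<v(\mathbf{i})$ for all $\mathbf{i}$. A set of configurations is ordered if any two members $u,v$ satisfy $u<v$, $u=v$ or $u>v$. $\Gamma_0$ is the set of configurations with $u(\mathbf{i}+\mathbf{e}_k)=u(\mathbf{i})$ for all $1\le k\le n$ (i.e. constants), $J_0(u)=S_{\mathbf{0}}(u)$, $c_0=\inf_{\Gamma_0}J_0$, $\mathcal{M}_0=\{u\in\Gamma_0:J_0(u)=c_0\}$. *)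

(* Defs.v *)
From HB Require Import structures.
From mathcomp Require Import all_boot all_order all_algebra.
From mathcomp Require Import all_classical all_reals all_analysis.
Import Order.TTheory GRing.Theory Num.Theory.
Import numFieldNormedType.Exports.

Set Implicit Arguments.
Unset Strict Implicit.
Unset Printing Implicit Defensive.

Local Open Scope classical_set_scope.
Local Open Scope ring_scope.

Definition l1norm (n : nat) (i : 'rV[int]_n) : nat :=
  (\sum_(k < n) `|i ord0 k|)%N.

Definition unitv (n : nat) (k : 'I_n) : 'rV[int]_n := delta_mx ord0 k.

Definition B (n r : nat) : Type := {k : 'rV[int]_n | (l1norm k <= r)%N}.

(* The coordinates may be indexed by a finite type (B n r) or an infinite one
   ('rV[int]_n): only the i-th coordinate varies. *)
Definition partial (R : realType) (T : eqType) (i : T)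
    (f : (T -> R) -> R) (u : T -> R) : R :=
  derive1 (fun t : R => f [eta u with i |-> t]) (u i).

Definition partial_exists (R : realType) (T : eqType) (i : T)
    (f : (T -> R) -> R) : Prop :=
  forall u : T -> R, derivable (fun t : R => f [eta u with i |-> t]) (u i) 1.

(* {ptws T -> R} is the product topology; for T = B n r, which is finite, it is
   the usual topology of a finite-dimensional space. *)
Definition C0 (R : realType) (T : eqType) (f : (T -> R) -> R) : Prop :=
  continuous (f : {ptws T -> R} -> R).

Definition C1 (R : realType) (T : eqType) (f : (T -> R) -> R) : Prop :=
  C0 f /\ forall i, partial_exists i f /\ C0 (partial i f).

Definition C2 (R : realType) (T : eqType) (f : (T -> R) -> R) : Prop :=
  C1 f /\ forall i, C1 (partial i f).

Record admissible (R : realType) (n r : nat) (s : (B n r -> R) -> R) : Prop :=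
  Admissible {
    adm_S1 : forall u : B n r -> R, s (u \+ cst 1) = s u;
    adm_S2_lbound : has_lbound (range s);
    adm_S2_coercive : forall k j : B n r, l1norm (val k - val j) = 1%N ->
      forall M : R, exists K : R, forall u : B n r -> R,
        K <= `|u k - u j| -> M <= s u;
    adm_S3_le0 : forall k j : B n r, k <> j ->
      forall u : B n r -> R, partial k (partial j s) u <= 0;
    adm_S3_lt0 : forall z j : B n r, val z = 0 -> l1norm (val j) = 1%N ->
      forall u : B n r -> R, partial z (partial j s) u < 0
  }.

Definition config (R : realType) (n : nat) : Type := 'rV[int]_n -> R.

Definition tau (R : realType) (n : nat) (j : 'I_n) (m : int)
    (u : config R n) : config R n :=
  fun i => u (i - m *: unitv j).

Definition restrictB (R : realType) (n r : nat) (u : config R n) : B n r -> R :=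
  fun k => u (val k).

(* The fold applies the shift in the first direction first. *)
Definition locpot (R : realType) (n r : nat) (s : (B n r -> R) -> R)
    (j : 'rV[int]_n) (u : config R n) : R :=
  s (restrictB (foldl (fun v k => tau k (- j ord0 k) v) u (enum 'I_n))).

(* The index set is finite, so the fsbigop junk value for infinite supports does
   not occur. *)
Definition EL_solution (R : realType) (n r : nat) (s : (B n r -> R) -> R)
    (u : config R n) : Prop :=
  forall i : 'rV[int]_n,
    \sum_(j \in [set j : 'rV[int]_n | (l1norm (j - i) <= r)%N])
      partial i (locpot s j) u = 0.

(* Strict at every site, unlike the strict part of the pointwise order. *)
Definition config_lt (R : realType) (n : nat) (u v : config R n) : Prop :=
  forall i, u i < v i.

Definition ordered_set (R : realType) (n : nat) (A : set (config R n)) : Prop :=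
  forall u v, A u -> A v -> [\/ config_lt u v, u = v | config_lt v u].

Definition Gamma0 (R : realType) (n : nat) : set (config R n) :=
  [set u | forall (i : 'rV[int]_n) (k : 'I_n), u (i + unitv k) = u i].

Definition J0 (R : realType) (n r : nat) (s : (B n r -> R) -> R)
    (u : config R n) : R := locpot s 0 u.

(* The set is nonempty (constants) and bounded below when adm_S2_lbound holds,
   so this inf is the true infimum. *)
Definition c0 (R : realType) (n r : nat) (s : (B n r -> R) -> R) : R :=
  inf (J0 s @` @Gamma0 R n).

Definition M0 (R : realType) (n r : nat) (s : (B n r -> R) -> R) :
    set (config R n) :=
  [set u | Gamma0 u /\ J0 s u = c0 s].

(* Main.v *)
Require Import Defs.
From mathcomp Require Import all_boot all_order all_algebra.
From mathcomp Require Import all_classical all_reals all_analysis.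
From mathcomp Require Import zify lra.
Import Order.TTheory GRing.Theory Num.Theory.
Import numFieldNormedType.Exports.
Local Open Scope classical_set_scope.

(** A configuration invariant under all unit shifts is constant
([Gamma0_cst]), so everything is decided by the one-variable function
g(c) = s(cst c).  By (S1) it is 1-periodic, and it is continuous, hence it
attains its minimum ([periodic_min]): this makes [M0] nonempty.  Constants are
compared through their values, so [M0] inherits the total order of the reals.

At a minimizer c one has g'(c) = 0.  By the chain rule along the diagonal
([is_derive_diagonal]), g'(c) is the sum of all the partial derivatives of s at
the constant c.  On the other side, the local potentials are translates of one
function, and a constant is unchanged by translation: differentiating S_j in
u(i) at a constant is differentiating s in the coordinate k = i - j.  As j runs
over the ball of radius r around i, k runs over the whole of B, so the
Euler-Lagrange sum at i is g'(c) ([sum_partial_locpot_cst]) and it vanishes.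

The chain rule follows from the continuity of the partial derivatives
([is_derive_partials]): coordinates are moved one after the other, and each
increment is given by the mean value theorem ([partial_MVT]) at an intermediate
point that tends to the base point. *)

(** * Directional derivatives of C1 functions on a product *)

Section DirectionalDerivative.
Local Open Scope ring_scope.

(** The product topology is the supremum of the topologies induced by the
evaluations, which are onto, so convergence can be tested on their images. *)
Lemma cvg_ptws (T : eqType) (V : topologicalType) (S : Type)
    (F : set_system S) (w : S -> T -> V) (u : T -> V) :
  Filter F -> (forall x, w t x @[t --> F] --> u x) ->
  w t @[t --> F] --> (u : {ptws T -> V}).
Proof.
move=> FF wu; apply/cvg_sup => x; apply/cvg_image.
  by rewrite eqEsubset; split=> // y _; exists (fun=> y).
move=> A /= /wu FA; exists (@^~ x @^-1` A) => //.
by rewrite image_preimage// eqEsubset; split=> // y _; exists (fun=> y).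
Qed.

(** The bound on c keeps the intermediate point close to the base point without
distinguishing whether a <= b or b <= a. *)
Lemma partial_MVT (R : realType) (T : eqType) (f : (T -> R) -> R) (k : T)
    (w : T -> R) (a b : R) :
  partial_exists k f ->
  exists2 c, `|c - a| <= `|b - a| &
    f [eta w with k |-> b] - f [eta w with k |-> a] =
    partial k f [eta w with k |-> c] * (b - a).
Proof.
move=> fk; pose F (t : R) := f [eta w with k |-> t].
have Fder (x : R) : is_derive x 1 F (partial k f [eta w with k |-> x]).
  have upd2 : (fun t => f [eta [eta w with k |-> x] with k |-> t]) = F.
    by apply/funext => t; congr f; apply/funext => y /=; case: eqP.
  have := fk [eta w with k |-> x]; rewrite /partial upd2 /= eqxx => dF.
  by split=> //; rewrite derive1E.
have Fcont (A : set R) : {within A, continuous F}.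
  apply: continuous_subspaceT => x; apply/differentiable_continuous.
  exact/derivable1_diffP.
have [ab|/ltW ba] := leP a b.
  have [c + ->] := MVT_segment ab (fun x _ => Fder x) (Fcont _).
  rewrite in_itv/= => /andP[ac cb]; exists c => //.
  by rewrite !ger0_norm ?subr_ge0// lerD2r.
have [c + Fba] := MVT_segment ba (fun x _ => Fder x) (Fcont _).
rewrite in_itv/= => /andP[bc ca]; exists c.
  by rewrite -normrN -(normrN (b - a)) !opprB !ger0_norm ?subr_ge0// lerB.
by rewrite -opprB Fba -mulrN opprB.
Qed.

(** Chain rule along the part of the direction v supported by l.  Letting the
list of moved coordinates grow one element at a time reduces the claim to the
continuity of a single partial derivative at u.  The induction is run on
Caratheodory slopes, functions g continuous at 0 such that the increment of f
at time t is g t * t: the slopes of successive moves add up, and a coordinate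
that does not move (v k = 0) raises no division by zero. *)
Lemma is_derive_partials (R : realType) (T : choiceType) (f : (T -> R) -> R)
    (u v : T -> R) (l : seq T) :
  C1 f -> uniq l ->
  is_derive (0 : R) (1 : R)
    (fun t : R => f (fun x => if x \in l then u x + t * v x else u x))
    (\sum_(k <- l) partial k f u * v k).
Proof.
move=> [_ fC1].
pose h (m : seq T) (t : R) x : R := if x \in m then u x + t * v x else u x.
have h0 m : h m 0 = u by apply/funext => x; rewrite /h mul0r addr0 if_same.
elim: l => [|k l IHl] /=.
  by move=> _; rewrite big_nil; exact: is_derive_cst.
move=> /andP[kl /IHl]; rewrite -[X in is_derive _ _ X _]/(fun t => f (h l t)).
rewrite -[X in _ -> is_derive _ _ X _]/(fun t => f (h (k :: l) t)).
move=> /is_derive1_caratheodory[g [gE gcont g0]].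
have [fk fkcont] := fC1 k.
(* [h (k :: l) t] and [h l t] differ only in the coordinate k. *)
have step t := @partial_MVT R T f k (h l t) (u k) (u k + t * v k) fk.
have /choice[c cP] (t : R) : exists c : R, `|c - u k| <= `|t * v k| /\
    f (h (k :: l) t) - f (h l t) =
    partial k f [eta h l t with k |-> c] * v k * t.
  have [c + cE] := step t; rewrite addrAC subrr add0r => cu.
  exists c; split=> //; rewrite -mulrA (mulrC (v k)).
  transitivity (partial k f [eta h l t with k |-> c] *
    (u k + t * v k - u k)); last by rewrite addrAC subrr add0r.
  rewrite -cE; congr (f _ - f _); apply/funext => x; rewrite /h /= ?in_cons.
    by case: eqP => [->|].
  by case: eqP => [->|//]; rewrite (negbTE kl).
(* The intermediate point, which tends to u pointwise as t tends to 0. *)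
pose w t : T -> R := [eta h l t with k |-> c t].
have c0 : c 0 = u k.
  by have [] := cP 0; rewrite mul0r normr0 normr_le0 subr_eq0 => /eqP.
have w0 : w 0 = u.
  by apply/funext => x; rewrite /w /= h0 c0; case: eqP => [->|].
have linear_cvg (x : T) : t * v x @[t --> (0 : R)] --> (0 : R).
  have id_cvg : t @[t --> (0 : R)] --> (0 : R) by exact: cvg_id.
  by have := cvgM id_cvg (cvg_cst (v x)); rewrite mul0r; exact.
have w_cvg : w t @[t --> (0 : R)] --> (u : {ptws T -> R}).
  apply: cvg_ptws => x; rewrite /w /=; case: eqP => [->|_].
    apply/cvgrPdist_le => e e0; near=> t.
    rewrite distrC; apply: (le_trans (cP t).1); near: t.
    by have /cvgr0_norm_le/(_ _ e0) := linear_cvg k.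
  rewrite /h; case: (x \in l); last exact: cvg_cst.
  by have := cvgD (cvg_cst (u x)) (linear_cvg x); rewrite addr0; exact.
apply/is_derive1_caratheodory.
exists (fun t => partial k f (w t) * v k + g t); split.
- move=> t; have := gE t; rewrite !subr0 mulrDl -(cP t).2 => <-.
  by rewrite !h0 addrA subrK.
- rewrite /prop_for /continuous_at /= w0; apply: cvgD => //.
  apply: cvgM; last exact: cvg_cst.
  exact: (cvg_comp _ _ w_cvg (fkcont u)).
- by rewrite w0 g0 big_cons.
Unshelve. all: by end_near. Qed.

Lemma is_derive_diagonal (R : realType) (T : choiceType) (f : (T -> R) -> R)
    (c : R) :
  finite_set [set: T] -> C1 f ->
  is_derive c (1 : R) (fun t : R => f (cst t))
    (\sum_(k \in [set: T]) partial k f (cst c)).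
Proof.
move=> Tfin fC1; pose l := finmap.enum_fset (fset_set [set: T]).
have lT x : x \in l by rewrite in_fset_set// in_setT.
have := is_derive_partials R T f (cst c) (cst 1) l fC1 (finmap.fset_uniq _).
rewrite fsbig_finite// -/l.
under [in X in X -> _]eq_bigr do rewrite /= mulr1.
move=> /is_derive1_caratheodory[g [gE gcont g0]].
apply/is_derive1_caratheodory; exists (fun t => g (t - c)); split.
- move=> t; have := gE (t - c); rewrite subr0 => <-.
  congr (f _ - f _); apply/funext => x; rewrite lT /= mulr1.
    by rewrite addrC subrK.
  by rewrite addr0.
- rewrite /prop_for /continuous_at subrr.
  apply: (cvg_comp (fun t => t - c) g); last exact: gcont.
  have id_cvg : t @[t --> c] --> c by exact: cvg_id.
  by have := cvgB id_cvg (cvg_cst c); rewrite subrr; exact.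
- by rewrite subrr.
Qed.

End DirectionalDerivative.

(** * Periodic functions attain their minimum *)

Section Periodic.
Local Open Scope ring_scope.

Lemma periodic_min (R : realType) (g : R -> R) :
  continuous g -> (forall t, g (t + 1) = g t) -> exists c, forall t, g c <= g t.
Proof.
move=> gcont gper.
have gnat (m : nat) t : g (t + m%:R) = g t.
  elim: m => [|m IHm]; first by rewrite addr0.
  by rewrite -addn1 natrD addrA gper.
have gint (m : int) t : g (t + m%:~R) = g t.
  case: m => m; first exact: gnat.
  by rewrite NegzE mulrNz -pmulrn -(gnat m.+1) subrK.
have [c _ cmin] := EVT_min (@ler01 R) (continuous_subspaceT gcont).
(* Translate t by an integer into the unit interval. *)
exists c => t; rewrite -[leRHS](gint (- Num.floor t)) mulrNz; apply: cmin.
have /andP[tl tu] := floor_itv t.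
by rewrite in_itv/= subr_ge0 tl lerBlDl; move: tu; rewrite intrD => /ltW.
Qed.

End Periodic.

(** * The lattice ball and constant configurations *)

Section Lattice.
Local Open Scope ring_scope.

Lemma l1normN (n : nat) (i : 'rV[int]_n) : l1norm (- i) = l1norm i.
Proof. by apply: eq_bigr => k _; rewrite mxE abszN. Qed.

Lemma le_l1norm (n : nat) (i : 'rV[int]_n) (k : 'I_n) :
  (`|i ord0 k| <= l1norm i)%N.
Proof. by rewrite /l1norm (bigD1 k)//= leq_addr. Qed.

(** Each coordinate of a point of the ball lies between -r and r, so the ball
embeds in the image of a finite box shifted by r. *)
Lemma finite_B (n r : nat) : finite_set [set: B n r].
Proof.
pose point (a : {ffun 'I_n -> 'I_(r + r).+1}) : 'rV[int]_n :=
  \row_k ((a k : nat)%:Z - r%:Z).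
have pointfin : finite_set (point @` setT) by exact/finite_image/finite_finset.
apply: sub_finite_set (finite_preimage (in2W val_inj) pointfin) => -[i ir] _ /=.
have ile k : (`|(i ord0 k + r%:Z)%R| < (r + r).+1)%N /\ 0 <= i ord0 k + r%:Z.
  by have := le_l1norm n i k; split; lia.
exists [ffun k => Ordinal (ile k).1] => //.
by apply/rowP => k; rewrite mxE ffunE /= gez0_abs ?addrK//; case: (ile k).
Qed.

Lemma foldl_tau (R : realType) (n : nat) (j : 'rV[int]_n) (l : seq 'I_n)
    (u : config R n) (i : 'rV[int]_n) :
  foldl (fun v k => tau k (- j ord0 k) v) u l i =
  u (i + \sum_(k <- l) j ord0 k *: unitv k).
Proof.
elim: l u => [|k l IHl] u /=; first by rewrite big_nil addr0.
by rewrite IHl /tau big_cons scaleNr opprK addrAC addrA.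
Qed.

(** The iterated shifts amount to the translation by j, as j is the sum of its
components along the unit vectors. *)
Lemma locpotE (R : realType) (n r : nat) (s : (B n r -> R) -> R)
    (j : 'rV[int]_n) (u : config R n) :
  locpot s j u = s (fun k => u (val k + j)).
Proof.
congr s; apply/funext => k; rewrite /restrictB foldl_tau.
by rewrite big_enum -row_sum_delta.
Qed.

Lemma Gamma0_cst (R : realType) (n : nat) (u : config R n) :
  Gamma0 u <-> u = cst (u 0).
Proof.
split=> [uper|->]; last by [].
have unat (m : nat) i k : u (i + m%:Z *: unitv k) = u i.
  elim: m => [|m IHm]; first by rewrite scale0r addr0.
  by rewrite intS scalerDl scale1r (addrC (unitv k)) addrA uper.
have uint (m : int) i k : u (i + m *: unitv k) = u i.
  case: m => m; first exact: unat.
  by rewrite NegzE scaleNr -(unat m.+1 _ k) subrK.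
apply/funext => i; rewrite [in LHS](row_sum_delta i) /=.
elim: (index_enum _) => [|k l IHl]; first by rewrite big_nil.
by rewrite big_cons addrC uint.
Qed.

(** At a constant, overwriting the site i of the configuration seen from j is
overwriting the coordinate i - j of a constant on the ball; this reindexes the
Euler-Lagrange sum by the ball. *)
Lemma sum_partial_locpot_cst (R : realType) (n r : nat)
    (s : (B n r -> R) -> R) (c : R) (i : 'rV[int]_n) :
  \sum_(j \in [set j : 'rV[int]_n | (l1norm (j - i) <= r)%N])
    partial i (locpot s j) (cst c) =
  \sum_(k \in [set: B n r]) partial k s (cst c).
Proof.
rewrite (reindex_fsbig (fun k : B n r => i - val k) setT).
  apply: eq_fsbigr => k _; rewrite /partial; congr (derive1 _ c).
  apply/funext => t; rewrite locpotE; congr s; apply/funext => k' /=.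
  by rewrite addrCA addrC -subr_eq0 addrK subr_eq0 -val_eqE.
split.
- by move=> k _ /=; rewrite addrAC subrr add0r l1normN (valP k).
- by move=> k k' _ _ /addrI/oppr_inj/val_inj.
- move=> j /= jr; have ijr : (l1norm (i - j) <= r)%N by rewrite -l1normN opprB.
  by exists (exist _ (i - j) ijr) => //=; rewrite subKr.
Qed.

End Lattice.

(** * Minimizers among the constants *)

Theorem theorem2p12 (R : realType) (n r : nat) (hn : (1 <= n)%N) (hr : (1 <= r)%N)
  (s : (B n r -> R) -> R) (hC2 : C2 s) (hs : admissible s) :
  M0 s !=set0 /\ ordered_set (M0 s) /\ (forall u : config R n, M0 s u -> EL_solution s u).
Proof.
pose g (c : R) := s (cst c).
have J0g c : J0 s (cst c) = g c by exact: locpotE.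
have gder c : is_derive c (1 : R)%R g _ :=
  is_derive_diagonal R _ s c (finite_B n r) hC2.1.
have [c cmin] : exists c, forall t, (g c <= g t)%R.
  apply: periodic_min => [t|t]; last exact: adm_S1 hs (cst t).
  by apply/differentiable_continuous/derivable1_diffP; exact: ex_derive.
have c0E : c0 s = g c.
  have glb : lbound (J0 s @` @Gamma0 R n) (g c).
    by move=> _ [u /Gamma0_cst -> <-]; rewrite J0g.
  have gJ : (J0 s @` @Gamma0 R n) (g c) by exists (cst c) => //; exact: J0g.
  by apply/eqP; rewrite eq_le ge_inf ?lb_le_inf//; exists (g c).
split; first by exists (cst c); split=> //; rewrite J0g c0E.
split.
  move=> u v [/Gamma0_cst -> _] [/Gamma0_cst -> _].
  by have [uv|uv|->] := ltgtP (u 0%R) (v 0%R);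
    [apply: Or31|apply: Or33|apply: Or32].
move=> u [/Gamma0_cst -> +] i; move: (u 0%R) => a; rewrite J0g c0E => ga.
rewrite sum_partial_locpot_cst.
have amin : is_derive a (1 : R)%R g 0%R.
  apply: (@derive1_at_min _ _ (a - 1) (a + 1))%R => [|t _||t _].
  - by rewrite lerD2l; lra.
  - exact: ex_derive.
  - by rewrite in_itv/=; apply/andP; split; lra.
  - by rewrite ga.
by rewrite -(derive_val (is_derive := gder a)) (derive_val (is_derive := amin)).
Qed.
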